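(* Let $P$ be a path connected finite space and let $\mathcal{K}(P)$ be its order complex. Then $\mathrm{TC}(\mathcal{K}(P))\le \mathrm{CC}(P)$.
   Context: A finite space is a finite $T_0$ topological space, identified with a finite poset: $x\le y$ iff $x$ lies in the smallest open set containing $y$; open sets are the down-sets, and continuous maps are order-preserving maps. The order complex $\mathcal{K}(P)$ is the simplicial complex (considered via its geometric realization) whose $n$-simplices are chains $p_0<\dots<p_n$ in $P$. For $m\ge 0$, $J_m$ is the finite fence on $\{0,\dots,m\}$ with order $0<1>2<\cdots m$; $P^{J_m}$ is the finite space of continuous maps $J_m\to P$ with the pointwise order, and $q_m:P^{J_m}\to P\times P$, $q_m(\gamma)=(\gamma(0),\gamma(m))$. $\mathrm{CC}_m(P)$ is the smallest $n\ge 0$ such that there is an open cover $\{Q_i\}_{i=1}^n$ of $P\times P$ with continuous sections $Q_i\to P^{J_m}$ of $q_m$ ($\infty$ if none), and $\mathrm{CC}(P)=\min_{m\ge0}\mathrm{CC}_m(P)$. For a path connected space $X$, $\mathrm{TC}(X)$ is the smallest $n\ge 0$ such that there is an open cover $\{U_i\}_{i=1}^n$ of $X\times X$ with continuous sections $U_i\to X^I$ of the path fibration $p(\gamma)=(\gamma(0),\gamma(1))$, $X^I$ the space of paths $[0,1]\to X$ with the compact-open topology ($\infty$ if none). *)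

(* Defs.v *)
From HB Require Import structures.
From mathcomp Require Import all_boot all_order all_algebra.
From mathcomp Require Import all_classical all_reals all_analysis.

Set Implicit Arguments.
Unset Strict Implicit.
Unset Printing Implicit Defensive.

Import Order.TTheory GRing.Theory Num.Theory.
Import numFieldNormedType.Exports.

Local Open Scope classical_set_scope.
Local Open Scope ring_scope.

Definition fspace {d} (P : porderType d) : Type := P.

Section FSpace.
Context {d} {P : porderType d}.

Definition downset (A : set P) : Prop :=
  forall x y, (x <= y)%O -> A y -> A x.

Fact downsetT : downset setT.
Proof. by []. Qed.

Fact downsetI : setI_closed downset.
Proof.
move=> A B dA dB x y xy [Ay By].
by split; [exact: dA Ay | exact: dB By].
Qed.

Fact downset_bigcup (I : Type) (f : I -> set P) :
  (forall i, downset (f i)) -> downset (\bigcup_i f i).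
Proof. by move=> df x y xy [i _ fy]; exists i => //; exact: df xy fy. Qed.

HB.instance Definition _ := Choice.copy (fspace P) P.
HB.instance Definition _ :=
  isOpenTopological.Build (fspace P) downsetT downsetI downset_bigcup.

Lemma fspace_openE : @open (fspace P) = downset.
Proof.
rewrite funeqE => A; rewrite propeqE openE; split.
- move=> oA x y xy Ay.
  by have [B [dB By BA]] := oA y Ay; apply: BA; exact: dB xy By.
- by move=> dA x Ax; exists A; split.
Qed.

End FSpace.

Lemma fspace_continuousP {d d'} {P : porderType d} {Q : porderType d'}
    (f : fspace P -> fspace Q) :
  continuous f <-> forall x y : P, (x <= y)%O -> (f x <= f y :> Q)%O.
Proof.
split=> [/continuousP cf x y xy|hf].
- have := cf [set z : Q | (z <= f y :> Q)%O].
  rewrite !fspace_openE => /(_ _ x y xy); apply => /=.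
    by move=> a b /= ab; exact: le_trans.
  exact: (lexx (f y : Q)).
- apply/continuousP => A; rewrite !fspace_openE => dA x y xy /=.
  by apply: dA; exact: hf.
Qed.

Fact fence_display : Order.disp_t. Proof. exact: Order.Disp tt tt. Qed.

Definition fence (m : nat) : Type := 'I_m.+1.

Section Fence.
Variable m : nat.

(* 0 < 1 > 2 < 3 > ... : adjacent elements are comparable, odd ones on top *)
Definition fence_le (i j : 'I_m.+1) : bool :=
  (i == j) || odd j && ((i.+1 == j :> nat) || (j.+1 == i :> nat)).

Fact fence_le_refl : reflexive fence_le.
Proof. by move=> i; rewrite /fence_le eqxx. Qed.

Let odd_adj (i j : 'I_m.+1) :
  (i.+1 == j :> nat) || (j.+1 == i :> nat) -> odd i = ~~ odd j.
Proof. by case/orP=> /eqP <- /=; rewrite ?negbK. Qed.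

Fact fence_le_anti : antisymmetric fence_le.
Proof.
move=> i j /andP[/orP[/eqP//|/andP[oj /odd_adj oi]]].
by case/orP=> [/eqP//|/andP[]]; rewrite oi oj.
Qed.

Fact fence_le_trans : transitive fence_le.
Proof.
move=> j i k /orP[/eqP-> //|/andP[oj ij]] /orP[/eqP<-|/andP[ok /odd_adj]].
- by rewrite /fence_le oj ij orbT.
- by rewrite oj ok.
Qed.

HB.instance Definition _ := Finite.copy (fence m) 'I_m.+1.
HB.instance Definition _ := Order.Le_isPOrder.Build fence_display (fence m)
  fence_le_refl fence_le_anti fence_le_trans.

End Fence.

Definition fence_maps {d} (P : porderType d) (m : nat) : Type :=
  continuousType (fspace (fence m)) (fspace P).

Section FenceMaps.
Context {d} {P : porderType d} {m : nat}.

HB.instance Definition _ := Choice.copy (fence_maps P m)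
  (continuousType (fspace (fence m)) (fspace P)).

Definition fence_ev (f : fence_maps P m) (j : fence m) : P :=
  (f : continuousType _ _) j.

Definition fence_maps_le (f g : fence_maps P m) : bool :=
  `[< forall j : fence m, (fence_ev f j <= fence_ev g j)%O >].

Fact fence_maps_le_refl : reflexive fence_maps_le.
Proof. by move=> f; apply/asboolP. Qed.

Fact fence_maps_le_anti : antisymmetric fence_maps_le.
Proof.
move=> f g /andP[/asboolP fg /asboolP gf]; apply/continuousEP => j.
by apply: (@le_anti _ P); apply/andP; split; [exact: fg | exact: gf].
Qed.

Fact fence_maps_le_trans : transitive fence_maps_le.
Proof.
move=> g f h /asboolP fg /asboolP gh; apply/asboolP => j.
exact: le_trans (fg j) (gh j).
Qed.

HB.instance Definition _ := Order.Le_isPOrder.Build d (fence_maps P m)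
  fence_maps_le_refl fence_maps_le_anti fence_maps_le_trans.

End FenceMaps.

Definition fence_endpoints {d} (P : porderType d) (m : nat)
    (f : fspace (fence_maps P m)) : fspace P * fspace P :=
  (fence_ev f ord0, fence_ev f ord_max).

Definition section_cover {E B : topologicalType} (q : E -> B) (n : nat) : Prop :=
  exists U : 'I_n -> set B,
    [/\ forall i, open (U i),
        \bigcup_i U i = setT &
        forall i, exists s : U i -> E,
          continuous s /\ forall b : U i, q (s b) = \val b].

(* The infimum of a nonempty set of naturals is its least element, and
   [ereal_inf set0 = +oo]. *)
Definition section_number (R : realType) {E B : topologicalType} (q : E -> B) :
    \bar R :=
  ereal_inf [set n%:R%:E | n in section_cover q].

Definition CCm (R : realType) {d} (P : porderType d) (m : nat) : \bar R :=
  section_number R (@fence_endpoints d P m).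

Definition CC (R : realType) {d} (P : porderType d) : \bar R :=
  ereal_inf (range (CCm R P)).

Definition unitI (R : realType) : topologicalType := `[0%R, 1%R]%classic : set R.

Fact unitI0_subproof (R : realType) : (0 : R) \in (`[0, 1]%classic : set R).
Proof. by rewrite inE /= in_itv /= lexx ler01. Qed.

Fact unitI1_subproof (R : realType) : (1 : R) \in (`[0, 1]%classic : set R).
Proof. by rewrite inE /= in_itv /= lexx ler01. Qed.

Definition unitI0 (R : realType) : unitI R := SigSub (unitI0_subproof R).
Definition unitI1 (R : realType) : unitI R := SigSub (unitI1_subproof R).

Definition path_space (R : realType) (X : topologicalType) : Type :=
  continuousType (unitI R) X.

HB.instance Definition _ (R : realType) (X : topologicalType) :=
  Choice.copy (path_space R X) (continuousType (unitI R) X).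
HB.instance Definition _ (R : realType) (X : topologicalType) :=
  Topological.copy (path_space R X)
    (initial_topology
      ((fun f : continuousType (unitI R) X => f : unitI R -> X) :
         path_space R X -> {compact-open, unitI R -> X})).

Definition path_ev {R : realType} {X : topologicalType} (f : path_space R X)
  (t : unitI R) : X := (f : continuousType _ _) t.

Definition path_endpoints (R : realType) (X : topologicalType)
    (f : path_space R X) : X * X :=
  (path_ev f (unitI0 R), path_ev f (unitI1 R)).

Definition TC (R : realType) (X : topologicalType) : \bar R :=
  section_number R (@path_endpoints R X).

Definition path_connected (R : realType) (X : topologicalType) : Prop :=
  forall x y : X, exists f : path_space R X, path_endpoints f = (x, y).

Record simplicial_complex (V : finType) := SimplicialComplex {
  simplices :> {set {set V}} ;
  simplex_neq0 : finset.set0 \notin simplices ;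
  face_simplex : forall s t : {set V},
    s \in simplices -> t \subset s -> t != finset.set0 -> t \in simplices }.

(* Barycentric coordinates; as the vertex set is finite, the weak topology with
   respect to the closed simplices is the subspace topology from [R^V]. *)
Definition barycentric (R : realType) (V : finType) (K : simplicial_complex V) :
    set {ptws V -> R} :=
  [set t : {ptws V -> R} | [/\ forall v, 0 <= t v,
    \sum_v t v = 1 & finset (fun v => t v != 0) \in simplices K]].

Definition realization (R : realType) (V : finType) (K : simplicial_complex V) :
  topologicalType := @barycentric R V K.

Section OrderComplex.
Context {d} (P : finPOrderType d).

Definition chains : {set {set P}} :=
  finset (fun s : {set P} => (s != finset.set0) &&
    [forall x in s, forall y in s, (x >=< y)%O]).

Fact chains_neq0 : finset.set0 \notin chains.
Proof. by rewrite finset.inE eqxx. Qed.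

Fact chains_face (s t : {set P}) :
  s \in chains -> t \subset s -> t != finset.set0 -> t \in chains.
Proof.
rewrite !finset.inE => /andP[_ /forall_inP cs] /fintype.subsetP ts ->.
apply/forall_inP => x xt; apply/forall_inP => y yt.
exact: (forall_inP (cs x (ts x xt)) y (ts y yt)).
Qed.

Definition order_complex : simplicial_complex P :=
  SimplicialComplex chains_neq0 chains_face.

End OrderComplex.

(* Main.v *)
(* Regard points [x], [y] of the order complex as probability weights on
   chains.  Laying both chains out along the unit interval and measuring
   overlaps gives a weight on [P * P], continuous in [(x, y)], whose support is
   a chain of pairs with entries in the supports of [x] and [y].  For [Q] in the
   cover of [P * P], let [U] be the set of [(x, y)] for which some pair in [Q]
   carries mass; restrict to [Q] and normalize.  A section over [Q] amounts to
   monotone maps [s_0 = fst, ..., s_m = snd] from [Q] to [P] that are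
   consecutively comparable.  The pushforwards of the weight along
   [s_0, ..., s_m] are successively homotopic (move the mass of the chain
   progressively, from one end to the other), and the first and the last are
   joined to [x] and [y] by segments, because their supports lie in those of
   [x] and [y].  Currying this homotopy gives the section over [U]. *)
Require Import Defs.
From HB Require Import structures.
From mathcomp Require Import all_boot all_order all_algebra.
From mathcomp Require Import all_classical all_reals all_analysis.
From mathcomp Require Import lra.

Set Implicit Arguments.
Unset Strict Implicit.
Unset Printing Implicit Defensive.

Import Order.TTheory GRing.Theory Num.Theory.
Import numFieldNormedType.Exports.

Local Open Scope classical_set_scope.
Local Open Scope ring_scope.

(** * Continuity of real-valued functions *)

Section RealContinuity.
Context {R : realType} {A : topologicalType}.

Lemma continuous_sum (I : Type) (r : seq I) (D : pred I) (F : I -> A -> R) :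
  (forall i, D i -> continuous (F i)) ->
  continuous (fun a => \sum_(i <- r | D i) F i a).
Proof.
apply: (@continuous_big R I +%R 0 D _ A r F).
by move=> z; exact: (@add_continuous R^o z).
Qed.

Lemma continuous_minr (f g : A -> R) :
  continuous f -> continuous g -> continuous (fun a => Num.min (f a) (g a)).
Proof. by move=> cf cg a; apply: continuous_min; [exact: cf|exact: cg]. Qed.

Lemma continuous_maxr (f g : A -> R) :
  continuous f -> continuous g -> continuous (fun a => Num.max (f a) (g a)).
Proof. by move=> cf cg a; apply: continuous_max; [exact: cf|exact: cg]. Qed.

Lemma continuous_subr (f g : A -> R) :
  continuous f -> continuous g -> continuous (fun a => f a - g a).
Proof. by move=> cf cg a; apply: (@cvgB _ R^o); [exact: cf|exact: cg]. Qed.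

Lemma continuous_addr (f g : A -> R) :
  continuous f -> continuous g -> continuous (fun a => f a + g a).
Proof. by move=> cf cg a; apply: (@cvgD _ R^o); [exact: cf|exact: cg]. Qed.

Lemma continuous_mulr (f g : A -> R) :
  continuous f -> continuous g -> continuous (fun a => f a * g a).
Proof. by move=> cf cg a; apply: cvgM; [exact: cf|exact: cg]. Qed.

Lemma continuous_fst_comp {B : topologicalType} (f : A -> R) :
  continuous f -> continuous (fun z : A * B => f z.1).
Proof.
move=> cf z; apply: (@continuous_comp _ _ _ fst f z); last exact: cf.
exact: cvg_fst.
Qed.

End RealContinuity.

Lemma continuous_reparam {R : realType} {A : topologicalType}
    (H : A -> R -> R) (h : R -> R) :
  continuous (fun z : A * R => H z.1 z.2) -> continuous h ->
  continuous (fun z : A * R => H z.1 (h z.2)).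
Proof.
move=> cH ch z.
apply: (@continuous_comp _ _ _ (fun z : A * R => (z.1, h z.2))
  (fun z => H z.1 z.2)); last exact: cH.
apply: (@cvg_pair _ _ _ _ (nbhs z.1) (nbhs (h z.2))); first exact: cvg_fst.
by apply: (@continuous_comp _ _ _ snd h z); [exact: cvg_snd|exact: ch].
Qed.

(** * Points of the order complex as probability weights on chains *)

Section Weights.
Context {R : realType} {d : Order.disp_t} (P : finPOrderType d).
Implicit Types t : P -> R.

Definition chain_weight t : Prop :=
  [/\ forall v, 0 <= t v, \sum_v t v = 1 &
      forall u v, t u != 0 -> t v != 0 -> (u >=< v)%O].

(** A simplex must be nonempty; for the support of [t] this follows from total mass 1. *)
Lemma chain_weightP t :
  barycentric (order_complex P) (t : {ptws P -> R}) <-> chain_weight t.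
Proof.
split=> -[t0 t1 tc]; split=> //.
  move=> u v tu tv; move: tc; rewrite finset.inE => /andP[_ /forall_inP/(_ u)].
  by rewrite finset.inE => /(_ tu) /forall_inP/(_ v); rewrite finset.inE; apply.
rewrite finset.inE; apply/andP; split.
  apply/eqP => t0'; have := t1; rewrite big1 => [/eqP|v _].
    by rewrite eq_sym oner_eq0.
  have /eqP := congr1 (fun s : {set P} => v \in s) t0'.
  by rewrite finset.inE finset.in_set0 eqbF_neg negbK => /eqP.
apply/forall_inP => u; rewrite finset.inE => tu.
by apply/forall_inP => v; rewrite finset.inE; exact: tc.
Qed.

(** When the support of [t] is a chain laid out in increasing order, its element [c] occupies the
    interval from [mass_lt t c] to [mass_le t c]. *)
Definition mass_le t (c : P) : R := \sum_(e | (e <= c)%O) t e.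
Definition mass_lt t (c : P) : R := \sum_(e | (e < c)%O) t e.

Lemma mass_leE t c : mass_le t c = t c + mass_lt t c.
Proof.
rewrite /mass_le (bigD1 c) //=; congr (_ + _); apply: eq_bigl => e.
by rewrite lt_neqAle andbC.
Qed.

Section Nonneg.
Variable t : P -> R.
Hypothesis t0 : forall v, 0 <= t v.

Lemma mass_lt_ge0 c : 0 <= mass_lt t c.
Proof. exact: sumr_ge0. Qed.

Lemma mass_le_lt c c' : (c < c')%O -> mass_le t c <= mass_lt t c'.
Proof.
move=> cc'; rewrite /mass_lt (bigID (fun e => (e <= c)%O)) /=.
rewrite [X in _ <= X + _](_ : _ = mass_le t c).
  by rewrite lerDl sumr_ge0.
apply: eq_bigl => e; rewrite andbC.
by case: (boolP (e <= c)%O) => // /le_lt_trans->.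
Qed.

Lemma mass_le_total c : mass_le t c <= \sum_v t v.
Proof. by rewrite [leRHS](bigID (fun e => (e <= c)%O)) /= lerDl sumr_ge0. Qed.

End Nonneg.

(** Take [p] in the support with the fewest elements below it: a support element strictly below [p]
    would have fewer still. *)
Lemma chain_weight_min t : chain_weight t ->
  exists2 p, t p != 0 & mass_lt t p = 0.
Proof.
case=> t0 t1 tc.
have [p0 tp0] : exists p, t p != 0.
  apply: contrapT => /forallNP tn; move: t1; rewrite big1 => [/eqP|v _].
    by rewrite eq_sym oner_eq0.
  by apply/eqP/negPn/negP/tn.
have [p tp pmin] := @arg_minnP _ p0 (fun p => t p != 0)
  (fun p => #|[pred e | (e <= p)%O]|) tp0.
exists p => //; apply: big1 => e ep; apply/eqP/negPn/negP => te.
have := pmin _ te; rewrite leqNgt => /negP; apply.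
apply/proper_card/properP; split.
  apply/fintype.subsetP => x; rewrite !inE => xe.
  exact: le_trans xe (ltW ep).
by exists p; rewrite !inE ?lexx ?lt_geF.
Qed.

End Weights.

(** * Homotopies of families of weights *)

Section Homotopy.
Context {R : realType} {A : topologicalType} {d : Order.disp_t}
  (P : finPOrderType d).
Implicit Types f g h : A -> P -> R.

(* Time ranges over all of [R], so that a homotopy can be reparametrized
   without coercing into the unit interval. *)
Definition homotopic f g : Prop :=
  exists H : A -> R -> P -> R,
    [/\ forall v, continuous (fun z : A * R => H z.1 z.2 v),
        forall a t, chain_weight (H a t),
        forall a, H a 0 = f a & forall a, H a 1 = g a].

Lemma homotopic_sym f g : homotopic f g -> homotopic g f.
Proof.
case=> H [cH wH H0 H1]; exists (fun a t => H a (1 - t)); split=> //.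
- move=> v; apply: (@continuous_reparam _ _ (fun a t => H a t v)
    (fun t => 1 - t)) => //.
  by apply: continuous_subr => t; [exact: cvg_cst|exact: cvg_id].
- by move=> a; rewrite subr0.
- by move=> a; rewrite subrr.
Qed.

(* Concatenation without gluing: as each homotopy is frozen outside its half
   of the time interval, [H1 + H2 - g] equals [H1] and then [H2]. *)
Lemma homotopic_trans g f h : homotopic f g -> homotopic g h -> homotopic f h.
Proof.
case=> H1 [cH1 wH1 H10 H11] [H2 [cH2 wH2 H20 H21]].
pose lo (t : R) := Num.min (2 * t) 1.
pose hi (t : R) := Num.max (2 * t - 1) 0.
have cdbl : continuous (fun t : R => 2 * t).
  by apply: continuous_mulr => t; [exact: cvg_cst|exact: cvg_id].
have clo : continuous lo.
  by apply: continuous_minr => // t; exact: cvg_cst.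
have chi : continuous hi.
  apply: continuous_maxr; last by move=> t; exact: cvg_cst.
  by apply: continuous_subr => // t; exact: cvg_cst.
pose H a t v := H1 a (lo t) v + H2 a (hi t) v - g a v.
have HL a t : t <= 1 / 2 -> H a t = H1 a (2 * t).
  move=> t2; apply/funext => v; rewrite /H /lo /hi min_l; last by lra.
  by rewrite max_r ?H20 ?addrK //; lra.
have HR a t : 1 / 2 <= t -> H a t = H2 a (2 * t - 1).
  move=> t2; apply/funext => v; rewrite /H /lo /hi min_r; last by lra.
  by rewrite max_l ?H11 1?addrC ?addrA ?addNr ?add0r //; lra.
exists H; split.
- move=> v; apply: continuous_subr; first apply: continuous_addr.
  + exact: (@continuous_reparam _ _ (fun a t => H1 a t v) lo).
  + exact: (@continuous_reparam _ _ (fun a t => H2 a t v) hi).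
  (* Continuity of [g] comes from its being the slice of [H2] at time 0. *)
  + under eq_fun do rewrite -H20.
    apply: (@continuous_reparam _ _ (fun a t => H2 a t v) (fun=> 0)) => // t.
    exact: cvg_cst.
- by move=> a t; have [/ltW/HR|/HL] := ltP (1 / 2) t => ->.
- by move=> a; rewrite HL ?mulr0 //; lra.
- move=> a; rewrite HR; last by lra.
  by rewrite mulr1 (_ : 2 - 1 = 1) ?H21 //; lra.
Qed.

(** Every convex combination of [f a] and [g a] is supported in the support of [f a], hence on a
    chain. *)
Lemma homotopic_linear f g :
  (forall v, continuous (f ^~ v)) -> (forall v, continuous (g ^~ v)) ->
  (forall a, chain_weight (f a)) -> (forall a, chain_weight (g a)) ->
  (forall a v, g a v != 0 -> f a v != 0) -> homotopic f g.
Proof.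
move=> cf cg wf wg gf.
(* Time is clamped to the unit interval, so that the combination stays convex for all real [t]. *)
pose s (t : R) : R := Num.max 0 (Num.min 1 t).
have cs : continuous s.
  apply: continuous_maxr; first by move=> t; exact: cvg_cst.
  by apply: continuous_minr => t; [exact: cvg_cst|exact: cvg_id].
have s01 t : 0 <= s t <= 1.
  by rewrite /s le_max lexx ge_max ler01 ge_min lexx.
exists (fun a t v => (1 - s t) * f a v + s t * g a v); split.
- move=> v; have cst' : continuous (fun z : A * R => s z.2).
    by apply: (@continuous_reparam _ _ (fun _ t => t) s) => // z;
      exact: cvg_snd.
  apply: continuous_addr; apply: continuous_mulr => //.
  + by apply: continuous_subr => // z; exact: cvg_cst.
  + exact: (continuous_fst_comp (cf v)).
  + exact: (continuous_fst_comp (cg v)).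
- move=> a t; have [[f0 f1 fc] [g0 g1 gc]] := (wf a, wg a).
  have /andP[st0 st1] := s01 t.
  split=> [v||u v].
  + by rewrite addr_ge0 ?mulr_ge0 ?subr_ge0.
  + by rewrite big_split /= -!mulr_sumr f1 g1; lra.
  + have supp x : (1 - s t) * f a x + s t * g a x != 0 -> f a x != 0.
      apply: contra_neq => fx; rewrite fx mulr0 add0r.
      by have [->|/gf/eqP//] := eqVneq (g a x) 0; rewrite mulr0.
    by move=> /supp fu /supp; exact: fc.
- move=> a; apply/funext => v.
  by rewrite /s min_r // max_l // subr0 mul1r mul0r addr0.
- move=> a; apply/funext => v.
  by rewrite /s min_l // max_r // subrr mul1r mul0r add0r.
Qed.

End Homotopy.

(** * Pushforwards of weights along monotone maps *)

Section Push.
Context {R : realType} {d d' : Order.disp_t} {T : finPOrderType d}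
  {P : finPOrderType d'}.

Definition push (f : T -> P) (w : T -> R) (r : P) : R :=
  \sum_(c | f c == r) w c.

Lemma push_sum f w : \sum_r push f w r = \sum_c w c.
Proof. by rewrite [RHS](partition_big f predT). Qed.

Lemma push_ge0 f w : (forall c, 0 <= w c) -> forall r, 0 <= push f w r.
Proof. by move=> w0 r; exact: sumr_ge0. Qed.

Lemma push_supp f w r : push f w r != 0 -> exists2 c, f c = r & w c != 0.
Proof.
move=> wr; apply: contrapT => n; move: wr.
rewrite /push big1 ?eqxx // => c /eqP fc.
by apply/eqP/negPn/negP => wc; apply: n; exists c.
Qed.

Lemma continuous_push (A : topologicalType) f (w : A -> T -> R) :
  (forall c, continuous (w ^~ c)) ->
  forall r, continuous (fun a => push f (w a) r).
Proof. by move=> cw r; exact: continuous_sum. Qed.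

Lemma push_chain_weight (Q : pred T) (f : T -> P) (w : T -> R) :
  (forall c, w c != 0 -> Q c) ->
  (forall c c', Q c -> Q c' -> (c <= c')%O -> (f c <= f c')%O) ->
  chain_weight w -> chain_weight (push f w).
Proof.
move=> wQ fm [w0 w1 wc]; split; first exact: push_ge0.
  by rewrite push_sum.
move=> u v /push_supp[c <- wc0] /push_supp[c' <- wc0'].
by have /orP[cc|cc] := wc _ _ wc0 wc0';
  [apply: le_comparable|apply: ge_comparable]; apply: fm => //; exact: wQ.
Qed.

(* The part of the mass at [c] that lies below level [l] when the mass of the
   chain supporting [w] is laid out in increasing order on the unit interval. *)
Definition mass_below (w : T -> R) (l : R) (c : T) : R :=
  Num.min (mass_le w c) l - Num.min (mass_lt w c) l.

Lemma continuous_mass_below (A : topologicalType) (w : A -> T -> R) c :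
  (forall c, continuous (w ^~ c)) ->
  continuous (fun z : A * R => mass_below (w z.1) z.2 c).
Proof.
move=> cw; have cw1 e : continuous (fun z : A * R => w z.1 e).
  exact: (continuous_fst_comp (cw e)).
by apply: continuous_subr; apply: continuous_minr; try exact: continuous_sum;
  move=> z; exact: cvg_snd.
Qed.

(** At time [t] the mass below level [1 - t] is pushed by [f] and the rest by [g]. Only one element
    of the chain can be split at a time, and the image stays a chain: if [c] still carries [f]-mass
    and [c'] already carries [g]-mass, then [c <= c'], whence [f c <= f c' <= g c']. *)
Lemma homotopic_push (A : topologicalType) (Q : pred T) (w : A -> T -> R)
    (f g : T -> P) :
  (forall c, continuous (w ^~ c)) -> (forall a, chain_weight (w a)) ->
  (forall a c, w a c != 0 -> Q c) ->
  (forall c c', Q c -> Q c' -> (c <= c')%O -> (f c <= f c')%O) ->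
  (forall c c', Q c -> Q c' -> (c <= c')%O -> (g c <= g c')%O) ->
  (forall c, Q c -> (f c <= g c)%O) ->
  homotopic (fun a => push f (w a)) (fun a => push g (w a)).
Proof.
move=> cw ww wQ fm gm fg.
pose lo a t := mass_below (w a) (1 - t).
pose hi a t c := w a c - lo a t c.
have clo c : continuous (fun z : A * R => lo z.1 z.2 c).
  apply: (@continuous_reparam _ _ (fun a t => mass_below (w a) t c)
    (fun t => 1 - t)).
    exact: continuous_mass_below.
  by apply: continuous_subr => t; [exact: cvg_cst|exact: cvg_id].
have chi c : continuous (fun z : A * R => hi z.1 z.2 c).
  apply: continuous_subr => //; exact: (continuous_fst_comp (cw c)).
exists (fun a t r => push f (lo a t) r + push g (hi a t) r); split.
- by move=> r; apply: continuous_addr; apply: continuous_sum.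
- move=> a t; have [w0 w1 wc] := ww a.
  (* An element keeps [f]-mass only if its interval starts before the level, and has [g]-mass only
     if its interval ends after it. *)
  have lohi c : [/\ 0 <= lo a t c, 0 <= hi a t c,
      lo a t c != 0 -> mass_lt (w a) c < 1 - t &
      hi a t c != 0 -> 1 - t < mass_le (w a) c].
    rewrite /hi /lo /mass_below mass_leE.
    move: (w a c) (mass_lt (w a) c) (1 - t) (w0 c) => m L l m0.
    by case: (leP (m + L) l) => h1; case: (leP L l) => h2; split; try lra;
      apply: contra_neqT; rewrite -leNgt => h3; lra.
  have suppQ c : lo a t c != 0 \/ hi a t c != 0 -> w a c != 0.
    have [lo0 hi0 _ _] := lohi c; move=> h; apply/eqP => wc0.
    have lo_eq0 : lo a t c = 0 by move: hi0; rewrite /hi wc0; lra.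
    by move: h; rewrite /hi wc0 lo_eq0 subrr eqxx; case.
  split=> [r||u v].
  + by rewrite addr_ge0 // push_ge0 // => c; case: (lohi c).
  + rewrite big_split /= !push_sum -big_split /= -w1.
    by apply: eq_bigr => c _; rewrite /hi; lra.
  + have supp r : push f (lo a t) r + push g (hi a t) r != 0 ->
        exists c, (f c = r /\ lo a t c != 0) \/ (g c = r /\ hi a t c != 0).
      have [->|/push_supp[c fc lc] _] := eqVneq (push f (lo a t) r) 0.
        by rewrite add0r => /push_supp[c gc hc]; exists c; right.
      by exists c; left.
    have fgc c c' : lo a t c != 0 -> hi a t c' != 0 -> (f c <= g c')%O.
      move=> lc hc'; have wc0 := suppQ c (or_introl lc).
      have wc0' := suppQ c' (or_intror hc').
      (* If [c' < c], the interval of [c'] would end before that of [c] starts, yet the level lies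
         beyond the start of [c] and before the end of [c']. *)
      have cc' : (c <= c')%O.
        have [[_ _ /(_ lc) lt1 _] [_ _ _ /(_ hc') lt2]] := (lohi c, lohi c').
        have /orP[//|] := wc _ _ wc0 wc0'.
        rewrite le_eqVlt => /orP[/eqP->//|c'c].
        have := lt_trans (lt_le_trans lt2 (mass_le_lt w0 c'c)) lt1.
        by rewrite ltxx.
      apply: le_trans (fm _ _ (wQ _ _ wc0) (wQ _ _ wc0') cc') (fg _ _).
      exact: wQ wc0'.
    have mono (k : T -> P) :
        (forall c c', Q c -> Q c' -> (c <= c')%O -> (k c <= k c')%O) ->
        forall c c', w a c != 0 -> w a c' != 0 -> (k c >=< k c')%O.
      move=> km c c' c0 c0'; have /orP[cc|cc] := wc _ _ c0 c0';
        [apply: le_comparable|apply: ge_comparable]; apply: km => //;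
        by apply: wQ; eassumption.
    move=> /supp[c [[<- lc]|[<- hc]]] /supp[c' [[<- lc']|[<- hc']]].
    * by apply: (mono f) => //; apply: suppQ; left.
    * exact/le_comparable/fgc.
    * exact/ge_comparable/fgc.
    * by apply: (mono g) => //; apply: suppQ; right.
(* At time 0 the level is 1, the total mass, so [f] pushes everything; at time 1 it is 0, so [g]
   does. *)
- move=> a; have [w0 w1 _] := ww a; have lo0 c : lo a 0 c = w a c.
    have := mass_le_total w0 c; rewrite w1 => le1.
    move: (le1); rewrite /lo /mass_below subr0 mass_leE => le1'.
    by have wc0 := w0 c; rewrite !min_l //; lra.
  apply/funext => r.
  rewrite [X in _ + X]big1 => [|c _]; last by rewrite /hi lo0 subrr.
  by rewrite addr0; apply: eq_bigr => c _; rewrite lo0.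
- move=> a; have [w0 w1 _] := ww a; have lo1 c : lo a 1 c = 0.
    rewrite /lo /mass_below subrr !min_r ?subrr ?mass_lt_ge0 //.
    exact: sumr_ge0.
  apply/funext => r; rewrite [X in X + _]big1 => [|c _]; last by rewrite lo1.
  by rewrite add0r; apply: eq_bigr => c _; rewrite /hi lo1 subr0.
Qed.

End Push.

(** * The overlap weight on pairs *)

Section Coupling.
Context {R : realType} {d : Order.disp_t} (P : finPOrderType d).
Implicit Types x y : P -> R.

(* If the chains supporting [x] and [y] are laid out as consecutive intervals
   of lengths [x p] and [y q], this is the length of the overlap of the
   intervals of [p] and [q]. *)
Definition coupling x y (c : P *p P) : R :=
  Num.max 0 (Num.min (mass_le x c.1) (mass_le y c.2) -
             Num.max (mass_lt x c.1) (mass_lt y c.2)).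

Lemma coupling_ge0 x y c : 0 <= coupling x y c.
Proof. by rewrite /coupling le_max lexx. Qed.

Lemma coupling_lt x y c : coupling x y c != 0 ->
  [/\ mass_lt x c.1 < mass_le x c.1, mass_lt x c.1 < mass_le y c.2,
      mass_lt y c.2 < mass_le x c.1 & mass_lt y c.2 < mass_le y c.2].
Proof.
rewrite /coupling; case: (ltP 0) => [h _|_]; last by rewrite eqxx.
by move: h; rewrite subr_gt0 gt_max !lt_min => /andP[/andP[? ?] /andP[? ?]].
Qed.

Lemma coupling_supp x y c : coupling x y c != 0 -> x c.1 != 0 /\ y c.2 != 0.
Proof.
move/coupling_lt => [hx _ _ hy]; split.
- by apply: contraTneq hx => x0; rewrite mass_leE x0 add0r ltxx.
- by apply: contraTneq hy => y0; rewrite mass_leE y0 add0r ltxx.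
Qed.

Lemma coupling_chain x y c c' : chain_weight x -> chain_weight y ->
  coupling x y c != 0 -> coupling x y c' != 0 -> (c >=< c')%O.
Proof.
move=> [x0 _ xc] [y0 _ yc] zc zc'.
(* Otherwise the overlap of [b] would lie to the left of that of [b'] in the layout of [x], but to
   the right of it in the layout of [y]. *)
have no_cross b b' : coupling x y b != 0 -> coupling x y b' != 0 ->
    (b.1 < b'.1)%O -> (b'.2 < b.2)%O -> False.
  move=> /coupling_lt[_ _ b21 _] /coupling_lt[_ b12 _ _] lt1 lt2.
  have := lt_le_trans b21 (mass_le_lt x0 lt1).
  by move=> /lt_trans/(_ b12)/lt_le_trans/(_ (mass_le_lt y0 lt2)); rewrite ltxx.
have [xz yz] := coupling_supp zc; have [xz' yz'] := coupling_supp zc'.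
move: (xc _ _ xz xz') (yc _ _ yz yz'); rewrite /Order.comparable !leEprod.
have nc := no_cross _ _ zc zc'; have nc' := no_cross _ _ zc' zc.
(* With both coordinates comparable, only the two crossing patterns make the pairs incomparable. *)
case: (comparableP c.1 c'.1) nc nc' => [||//|];
  case: (comparableP c.2 c'.2) => // h h' nc nc' _ _; exfalso; auto.
Qed.

(** The intervals of the least support elements both start at 0 and have positive length, so they
    overlap. *)
Lemma coupling_neq0 x y : chain_weight x -> chain_weight y ->
  exists c, coupling x y c != 0.
Proof.
move=> wx wy; have [p xp xp0] := chain_weight_min wx.
have [q yq yq0] := chain_weight_min wy.
have [[x0 _ _] [y0 _ _]] := (wx, wy).
exists (p, q); rewrite /coupling /= !mass_leE xp0 yq0 !addr0 maxxx subr0.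
by rewrite gt_eqF // lt_max lt_min !lt_def xp yq x0 y0 orbT.
Qed.

Lemma continuous_coupling (A : topologicalType) (x y : A -> P -> R) c :
  (forall p, continuous (x ^~ p)) -> (forall p, continuous (y ^~ p)) ->
  continuous (fun a => coupling (x a) (y a) c).
Proof.
move=> cx cy; apply: continuous_maxr; first by move=> a; exact: cvg_cst.
by apply: continuous_subr; [apply: continuous_minr|apply: continuous_maxr];
  exact: continuous_sum.
Qed.

End Coupling.

(** * From comparable steps to a continuous section *)

Section Planner.
Context {R : realType} {d : Order.disp_t} (P : finPOrderType d).

Lemma homotopic_of_steps (A : topologicalType) (x y : A -> P -> R)
    (Q : pred (P *p P)) (m : nat) (s : nat -> P *p P -> P) :
  (forall p, continuous (x ^~ p)) -> (forall p, continuous (y ^~ p)) ->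
  (forall a, chain_weight (x a)) -> (forall a, chain_weight (y a)) ->
  (forall a, 0 < \sum_(c | Q c) coupling (x a) (y a) c) ->
  (forall c, Q c -> s 0%N c = c.1) -> (forall c, Q c -> s m c = c.2) ->
  (forall j c c', Q c -> Q c' -> (c <= c')%O -> (s j c <= s j c')%O) ->
  (forall j, (j < m)%N -> (forall c, Q c -> (s j c <= s j.+1 c)%O) \/
                          (forall c, Q c -> (s j.+1 c <= s j c)%O)) ->
  homotopic x y.
Proof.
move=> cx cy wx wy z0 s0 sm smono sstep.
pose S a := \sum_(c | Q c) coupling (x a) (y a) c.
pose w a c := if Q c then coupling (x a) (y a) c / S a else 0.
have wQ a c : w a c != 0 -> Q c by rewrite /w; case: ifP; rewrite ?eqxx.
have wz a c : w a c != 0 -> coupling (x a) (y a) c != 0.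
  rewrite /w; case: ifP => _; last by rewrite eqxx.
  by apply: contra_neq => ->; rewrite mul0r.
have ww a : chain_weight (w a).
  split.
  - move=> c; rewrite /w; case: ifP => // _.
    by rewrite divr_ge0 ?coupling_ge0 // ltW //; exact: z0.
  - by rewrite /w -big_mkcond /= -mulr_suml divff // gt_eqF //; exact: z0.
  - by move=> c c' /wz + /wz; exact: coupling_chain.
have cS : continuous S.
  by apply: continuous_sum => c _; exact: continuous_coupling.
have cw c : continuous (w ^~ c).
  rewrite /w; case: (Q c); last by move=> a; exact: cvg_cst.
  apply: continuous_mulr; first exact: continuous_coupling.
  by move=> a; apply: (cvgV _ (cS a)); rewrite gt_eqF //; exact: z0.
have ws j a : chain_weight (push (s j) (w a)).
  exact: (push_chain_weight (@wQ a) (smono j)).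
have cs j r : continuous (fun a => push (s j) (w a) r)
  by exact: continuous_push.
have x_s : homotopic x (fun a => push (s 0%N) (w a)).
  apply: homotopic_linear => // a v /push_supp[c <- wc].
  by rewrite s0 ?(wQ a) //; have [] := coupling_supp (wz _ _ wc).
have y_s : homotopic y (fun a => push (s m) (w a)).
  apply: homotopic_linear => // a v /push_supp[c <- wc].
  by rewrite sm ?(wQ a) //; have [] := coupling_supp (wz _ _ wc).
(* Walk along the fence, running the homotopy of [homotopic_push] backwards on descending steps. *)
have s_s : forall j, (j <= m)%N -> homotopic x (fun a => push (s j) (w a)).
  elim=> [//|j IH jm]; apply: (homotopic_trans (IH (ltnW jm))).
  have [le_s|ge_s] := sstep j jm.
    exact: (homotopic_push cw ww wQ (smono j) (smono j.+1) le_s).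
  exact/homotopic_sym/(homotopic_push cw ww wQ (smono j.+1) (smono j) ge_s).
exact: homotopic_trans (s_s m (leqnn m)) (homotopic_sym y_s).
Qed.

Local Notation K := (realization R (order_complex P)).

Definition coords (k : K) : P -> R := \val k.

Lemma coords_chain_weight k : chain_weight (coords k).
Proof. by apply/chain_weightP; exact: set_valP. Qed.

Lemma continuous_coords p : continuous (coords ^~ p).
Proof.
move=> k; apply: (@continuous_comp _ _ _ set_val
  (fun t : {ptws P -> R} => t p)).
  exact: initial_continuous.
exact: (@proj_continuous P (fun=> R) p).
Qed.

(** The realization carries the subspace topology of a product, so continuity is tested
    coordinatewise. *)
Lemma continuous_to_realization (A : topologicalType) (f : A -> K) :
  (forall p, continuous (fun a => coords (f a) p)) -> continuous f.
Proof.
move=> cf; apply: continuous_comp_initial => a.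
apply/cvg_sup => p; move: a.
exact: (@continuous_comp_initial _ _ _ (fun t : P -> R => t p)
  (set_val \o f) (cf p)).
Qed.

Lemma motion_planner (U : set (K * K)) :
  homotopic (fun a : U => coords (\val a).1) (fun a : U => coords (\val a).2) ->
  exists s : U -> path_space R K,
    continuous s /\ forall b : U, path_endpoints (s b) = \val b.
Proof.
case=> H [cH wH H0 H1].
have inK (z : U * unitI R) : H z.1 (\val z.2) \in barycentric (order_complex P).
  by apply/mem_set/chain_weightP; exact: wH.
pose F (z : U * unitI R) : K := SigSub (inK z).
have cF : continuous F.
  apply: continuous_to_realization => p z.
  apply: (@continuous_comp _ _ _ (fun z : U * unitI R => (z.1, \val z.2))
    (fun z : U * R => H z.1 z.2 p)); last exact: cH.
  apply: (@cvg_pair _ _ _ _ (nbhs z.1) (nbhs (\val z.2))); first exact: cvg_fst.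
  apply: (@continuous_comp _ _ _ snd (set_val : unitI R -> R) z).
    exact: cvg_snd.
  exact: initial_continuous.
have [cs cu] := continuous_curry cF.
pose s (u : U) : path_space R K :=
  HB.pack (curry F u) (isContinuous.Build _ _ _ (cu u)).
exists s; split.
  (* The topology on paths is initial for the map to the compact-open function space, so continuity
     of the curried map suffices. *)
  exact: (@continuous_comp_initial _ _ _ (fun f : continuousType (unitI R) K =>
    (f : unitI R -> K) : {compact-open, unitI R -> K}) s cs).
move=> b; rewrite /path_endpoints [RHS]surjective_pairing.
by congr (_, _); apply: val_inj; [exact: H0|exact: H1].
Qed.

End Planner.

(** * Combinatorial sections and transfer of covers *)

Lemma fence_section_steps {d : Order.disp_t} {P : porderType d} (m : nat)
    (Q : set (fspace P * fspace P)) (s : Q -> fspace (fence_maps P m)) :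
  continuous s -> (forall b : Q, fence_endpoints (s b) = \val b) ->
  exists r : nat -> P * P -> P,
    [/\ forall c, Q c -> r 0%N c = c.1, forall c, Q c -> r m c = c.2,
        forall j c c', Q c -> Q c' -> (c.1 <= c'.1)%O -> (c.2 <= c'.2)%O ->
          (r j c <= r j c')%O &
        forall j, (j < m)%N -> (forall c, Q c -> (r j c <= r j.+1 c)%O) \/
                               (forall c, Q c -> (r j.+1 c <= r j c)%O)].
Proof.
move=> cs es.
(* The value [c.1] outside [Q] is a mere default. *)
pose r (j : nat) (c : P * P) : P :=
  if pselect (Q c) is left Qc then fence_ev (s (SigSub (mem_set Qc))) (inord j)
  else c.1.
have rE j c (Qc : Q c) : r j c = fence_ev (s (SigSub (mem_set Qc))) (inord j).
  rewrite /r; case: pselect => // Qc'; congr (fence_ev (s _) _).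
  exact: val_inj.
have ends c (Qc : Q c) : (r 0%N c, r m c) = c.
  rewrite !rE -[RHS](es (SigSub (mem_set Qc))) /fence_endpoints.
  by congr pair; congr fence_ev; apply: (@ord_inj m.+1); rewrite inordK.
have step (c : P * P) (i j : nat) : Q c -> (i <= m)%N -> (j <= m)%N -> odd j ->
    (i.+1 == j) || (j.+1 == i) -> (r i c <= r j c)%O.
  move=> Qc im jm oj ij; rewrite !rE.
  have /fspace_continuousP := @cts_fun _ _
    (s (SigSub (mem_set Qc)) : continuousType _ _).
  apply; rewrite /Order.le /= /fence_le !inordK // oj ij.
  by rewrite orbT.
exists r; split.
- by move=> c /ends {2}<-.
- by move=> c /ends {2}<-.
- move=> j c c' Qc Qc' le1 le2; rewrite !rE.
  pose b : Q := SigSub (mem_set Qc); pose b' : Q := SigSub (mem_set Qc').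
  suff : (s b <= s b' :> fence_maps P m)%O by move=> /asboolP; exact.
  (* Continuity gives monotonicity: the maps below [s b'] form an open set, and its preimage, a
     neighbourhood of [b'], must contain every [b] of [Q] below [b']. *)
  have : nbhs b' (s @^-1` [set f | (f <= s b' :> fence_maps P m)%O]).
    apply: cs; apply: open_nbhs_nbhs; split; last exact: lexx.
    by rewrite fspace_openE => f g fg; exact: le_trans.
  case=> _ [[V oV <-] Vb'] /(_ b); apply.
  have [[A B] /= [nA nB]] := oV _ Vb'.
  apply; split.
  - move: nA; rewrite nbhsE => -[A' [+ A'c] A'A].
    by rewrite fspace_openE => dA'; apply: A'A; exact: dA' le1 A'c.
  - move: nB; rewrite nbhsE => -[B' [+ B'c] B'B].
    by rewrite fspace_openE => dB'; apply: B'B; exact: dB' le2 B'c.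
(* Odd fence points are on top, so a step goes down from odd [j] and up from even [j]. *)
- move=> j jm; have [oj|ej] := boolP (odd j); [right|left] => c Qc.
  + by apply: step; rewrite // ?eqxx ?orbT // ltnW.
  + by apply: step; rewrite // ?eqxx ?orbT //= ltnW.
Qed.

Lemma section_cover_order_complex {R : realType} {d : Order.disp_t}
    (P : finPOrderType d) (m n : nat) :
  section_cover (@fence_endpoints d P m) n ->
  section_cover (@path_endpoints R (realization R (order_complex P))) n.
Proof.
set K := realization R _; case=> Q [_ covQ secQ].
pose S i (xy : K * K) :=
  \sum_(c : P *p P | c \in Q i) coupling (coords xy.1) (coords xy.2) c.
have cS i : continuous (S i).
  apply: continuous_sum => c _; apply: continuous_coupling => p xy.
    apply: (@continuous_comp _ _ _ fst (fun k : K => coords k p)).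
      exact: cvg_fst.
    exact: continuous_coords.
  apply: (@continuous_comp _ _ _ snd (fun k : K => coords k p)).
    exact: cvg_snd.
  exact: continuous_coords.
exists (fun i => [set xy | 0 < S i xy]); split.
- move=> i; have := @open_comp _ _ (S i) [set r | 0 < r].
  by apply; [move=> xy _; exact: cS|exact: open_gt].
(* Some pair [c] carries mass, and any [Q i] containing [c] puts [xy] into the corresponding open
   set. *)
- rewrite -subTset => xy _.
  have [c zc] :=
    coupling_neq0 (coords_chain_weight xy.1) (coords_chain_weight xy.2).
  have [i _ Qc] : (\bigcup_i Q i) c by rewrite covQ.
  exists i => //=; rewrite /S (bigD1 c) /=; last exact/mem_set.
  apply: ltr_wpDr; first by apply: sumr_ge0 => ? _; exact: coupling_ge0.
  by rewrite lt_neqAle coupling_ge0 eq_sym zc.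
- move=> i; apply: motion_planner.
  have [s [cs es]] := secQ i.
  have [r [r0 rm rmono rstep]] := fence_section_steps cs es.
  have cval (h : K * K -> K) p : continuous h ->
      continuous (fun a : [set xy | 0 < S i xy] => coords (h (\val a)) p).
    move=> ch a.
    apply: (@continuous_comp _ _ _ set_val (fun xy => coords (h xy) p)).
      exact: initial_continuous.
    apply: (@continuous_comp _ _ _ h (fun k => coords k p)); first exact: ch.
    exact: continuous_coords.
  apply: (@homotopic_of_steps _ _ _ _ _ _ (fun c => c \in Q i) m r) => //.
  + by move=> p; apply: cval => z; exact: cvg_fst.
  + by move=> p; apply: cval => z; exact: cvg_snd.
  + by move=> a; exact: coords_chain_weight.
  + by move=> a; exact: coords_chain_weight.
  + by case=> xy Sxy; exact: set_mem Sxy.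
  + by move=> c /set_mem /r0.
  + by move=> c /set_mem /rm.
  + move=> j c c' /set_mem Qc /set_mem Qc'; rewrite leEprod => /andP[].
    exact: rmono.
  + by move=> j /rstep[h|h]; [left|right] => c /set_mem; exact: h.
Qed.

Theorem theorem4p4 (R : realType) (d : Order.disp_t) (P : finPOrderType d)
    (hP : path_connected R (fspace P)) :
  (TC R (realization R (order_complex P)) <= CC R P)%E.
Proof.
(* For each [m], every cover size admissible for [CCm] is admissible for [TC], which compares the
   infima. *)
apply: le_ereal_inf_tmp => _ [m _ <-]; apply: ereal_inf_le_tmp => _ [n sn <-].
by exists n => //; exact: section_cover_order_complex sn.
Qed.
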